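(* Let $Q \ll P$ be probability measures on a Polish space $\mathcal{X}$ with $r = dQ/dP$ and $L = D_{KL}(Q\|P) < \infty$. Let $\varphi \in L^2(Q)$, let $t \ge 0$ be such that $n = 2^{L+t}$ is a positive integer, and let $X_1, \dots, X_n$ be i.i.d. $P$-distributed. Define $I(\varphi) = \int_{\mathcal{X}} \varphi\, dQ$ and $I_n(\varphi) = \frac{1}{n}\sum_{i=1}^n \varphi(X_i) r(X_i)$. Then $$\mathbb{E}\big[|I_n(\varphi) - I(\varphi)|\big] \le \|\varphi\|_{L^2(Q)}\Big(2^{-t/4} + 2\sqrt{S_P(2^{L+t/2})}\Big).$$
   Context: $D_{KL}(Q\|P) = \mathbb{E}_{X\sim Q}[\log_2 r(X)]$. Define $w_P(h) = \mathbb{P}_{X\sim P}[r(X) \ge h]$, $W_P(h) = \int_0^h w_P(\eta)\,d\eta$ and $S_P(h) = 1 - W_P(h)$. *)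

(* Defs.v *)
From HB Require Import structures.
From mathcomp Require Import all_boot all_order all_algebra.
From mathcomp Require Import all_classical all_reals all_analysis.
Set Implicit Arguments. Unset Strict Implicit. Unset Printing Implicit Defensive.
Import Order.TTheory GRing.Theory Num.Theory.
Local Open Scope classical_set_scope.
Local Open Scope ring_scope.

Definition log2 {R : realType} (x : R) : R := ln x / ln 2.

Definition is_density {d} {T : measurableType d} {R : realType}
  (P Q : {measure set T -> \bar R}) (r : T -> R) : Prop :=
  measurable_fun setT r /\ (forall x, 0 <= r x) /\
  forall A, measurable A -> Q A = (\int[P]_(x in A) (r x)%:E)%E.

Definition wP {d} {T : measurableType d} {R : realType}
  (P : {measure set T -> \bar R}) (r : T -> R) (h : R) : R :=
  fine (P [set x | h <= r x]).

Definition WP {d} {T : measurableType d} {R : realType}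
  (P : {measure set T -> \bar R}) (r : T -> R) (h : R) : R :=
  fine (\int[lebesgue_measure]_(eta in `[0%R, h]) (wP P r eta)%:E)%E.

Definition SP {d} {T : measurableType d} {R : realType}
  (P : {measure set T -> \bar R}) (r : T -> R) (h : R) : R :=
  1 - WP P r h.

Definition iid_law {d d'} {T : measurableType d} {Om : measurableType d'}
  {R : realType} (Pr : probability Om R) (P : {measure set T -> \bar R})
  (n : nat) (X : 'I_n -> Om -> T) : Prop :=
  (forall i, measurable_fun setT (X i)) /\
  (forall i A, measurable A -> Pr (X i @^-1` A) = P A) /\
  (forall A : 'I_n -> set T, (forall i, measurable (A i)) ->
     Pr (\bigcap_i (X i @^-1` A i)) = (\prod_(i < n) Pr (X i @^-1` A i))%E).

Definition In_est {T : Type} {R : realType} (n : nat) (X : 'I_n -> T)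
  (phi r : T -> R) : R :=
  n%:R^-1 * \sum_(i < n) phi (X i) * r (X i).

(* Main.v *)
(* Cut the density at a height a: r = min(r, a) + (r - a)_+. By Fubini the
   integral of min(r, a) against P is W_P(a), so (r - a)_+ has P-mass S_P(a), and
   Cauchy-Schwarz, applied to phi (r - a)_+ <= (phi sqrt r) sqrt((r - a)_+),
   bounds the tail by ||phi|| sqrt(S_P(a)). The tail enters twice: in the
   estimator and in its mean. What remains is the Monte Carlo error of
   phi min(r, a), whose P-variance is at most a ||phi||^2 because
   min(r, a)^2 <= a r. This gives sqrt(a / n) + 2 sqrt(S_P(a)) for every a >= 0,
   and a = 2^(L + t/2), n = 2^(L + t) is the theorem. *)

Require Import Defs.
From HB Require Import structures.
From mathcomp Require Import all_boot all_order all_algebra.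
From mathcomp Require Import all_classical all_reals all_analysis.
From mathcomp Require Import measurable_realfun ring lra.
Import Order.TTheory GRing.Theory Num.Theory.
Local Open Scope classical_set_scope.
Local Open Scope ring_scope.

(** * Integrals against a density, and Cauchy-Schwarz with real bounds *)

(** The Radon-Nikodym derivative [g] of [Q] with respect to [P] and the given [r] have the same
    integral over every measurable set, hence agree [P]-a.e.; the change of variables known for [g]
    then passes to [r]. *)
Lemma ge0_integral_density {d} {T : measurableType d} {R : realType}
    (P Q : probability T R) (r : T -> R) (f : T -> R) :
  Q `<< P -> is_density P Q r ->
  measurable_fun setT f -> (forall x, 0 <= f x) ->
  (\int[Q]_x (f x)%:E = \int[P]_x (f x * r x)%:E)%E.
Proof.
move=> QP [mr [r0 Qr]] mf f0.
pose g := Radon_Nikodym_SigmaFinite.f Q P.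
have ig : P.-integrable setT g by exact: Radon_Nikodym_SigmaFinite.f_integrable.
have gr : ae_eq P setT g (EFin \o r).
  apply: integral_ae_eq => //; first exact/measurable_EFinP.
  move=> E _ mE.
  by rewrite -Radon_Nikodym_SigmaFinite.f_integral// -Qr.
rewrite -(Radon_Nikodym_SigmaFinite.change_of_variables QP)//; last first.
- exact/measurable_EFinP.
apply: ae_eq_integral => //.
- apply: emeasurable_funM; first exact/measurable_EFinP.
  exact: measurable_int ig.
- by apply/measurable_EFinP; exact: measurable_funM.
- have := ae_eqe_mul2l (EFin \o f) gr.
  by apply: filterS => x /= + _ => /(_ I) ->; rewrite EFinM.
Qed.

(** Hoelder's inequality with both exponents 2. Norms enter only through real bounds on integrals of
    squares, so that later uses involve no extended-real roots. *)
Lemma cauchy_schwarz_le {d} {T : measurableType d} {R : realType}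
    (mu : {measure set T -> \bar R}) (f g : T -> R) (a b : R) :
  measurable_fun setT f -> measurable_fun setT g -> 0 <= a -> 0 <= b ->
  (\int[mu]_x (f x ^+ 2)%:E <= (a ^+ 2)%:E)%E ->
  (\int[mu]_x (g x ^+ 2)%:E <= (b ^+ 2)%:E)%E ->
  (\int[mu]_x `|f x * g x|%:E <= (a * b)%:E)%E.
Proof.
move=> mf mg a0 b0 fa gb.
(* The 2-norm is the power 1/2 of the integral of the square, and this power is monotone on
   [0, +oo]. *)
have N2 h c : 0 <= c -> (\int[mu]_x (h x ^+ 2)%:E <= (c ^+ 2)%:E)%E ->
    ('N[mu]_2%:E[EFin \o h] <= c%:E)%E.
  move=> c0 hc; rewrite unlock /=.
  under eq_integral do rewrite powR_mulrn// real_normK ?num_real//.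
  have -> : c%:E = ((c ^+ 2)%:E `^ 2^-1)%E.
    by rewrite poweR_EFin powR12_sqrt ?sqr_ge0// sqrtr_sqr ger0_norm.
  have itv (y : \bar R) : (0 <= y)%E -> y \in `[0%E, +oo%E].
    by move=> y0; rewrite in_itv/= y0 leey.
  apply: gt0_ler_poweR => //; apply: itv; last by rewrite lee_fin sqr_ge0.
  by apply: integral_ge0 => x _; rewrite lee_fin sqr_ge0.
have half : 2^-1 + 2^-1 = 1 :> R by rewrite [RHS]splitr !div1r.
have := hoelder mu mf mg (ltr0n R 2) (ltr0n R 2) half.
rewrite Lnorm1 /= => /le_trans; apply.
rewrite EFinM.
by apply: lee_pmul; [exact: Lnorm_ge0|exact: Lnorm_ge0|exact: N2|exact: N2].
Qed.

(** Cauchy-Schwarz against the constant 1, whose square integrates to 1 under a probability. *)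
Lemma integral_abs_le_sqrt {d} {T : measurableType d} {R : realType}
    (P : probability T R) (f : T -> R) (a : R) :
  measurable_fun setT f -> 0 <= a ->
  (\int[P]_x (f x ^+ 2)%:E <= (a ^+ 2)%:E)%E ->
  (\int[P]_x `|f x|%:E <= a%:E)%E.
Proof.
move=> mf a0 fa.
have := cauchy_schwarz_le P f (cst 1) a 1 mf (measurable_cst (1 : R)) a0 ler01 fa.
under eq_integral do rewrite /= expr1n.
rewrite integral_cst//= probability_setT mule1 expr1n mulr1 lexx => /(_ isT).
by under eq_integral do rewrite /= mulr1.
Qed.

(** * Layer-cake formula for the truncated density *)

(** Tonelli on the indicator of 0 <= eta <= min(r x, h): for fixed eta in [0, h] its [P]-integral is
    [wP P r eta], for fixed x its Lebesgue integral is the length of [0, min(r x, h)]. *)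
Lemma integral_wP {d} {T : measurableType d} {R : realType}
    (P : probability T R) (r : T -> R) (h : R) :
  measurable_fun setT r -> (forall x, 0 <= r x) -> 0 <= h ->
  (\int[lebesgue_measure]_(eta in `[0%R, h]) (wP P r eta)%:E
   = \int[P]_x (Num.min (r x) h)%:E)%E.
Proof.
move=> mr r0 h0.
pose mu : {measure set (measurableTypeR R) -> \bar R} := @lebesgue_measure R.
pose F (p : T * measurableTypeR R) : \bar R :=
  (\1_`[0%R, Num.min (r p.1) h] p.2)%:E.
have mle (f g : T * measurableTypeR R -> R) :
    measurable_fun setT f -> measurable_fun setT g ->
    measurable [set p | f p <= g p].
  by move=> mf mg; rewrite -[X in measurable X]setTI; exact: measurable_fun_le.
have mF : measurable_fun setT F.
  apply/measurable_EFinP.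
  (* Joint measurability: the condition eta <= min(r x, h) is split, so that the region is cut out
     by three inequalities between measurable functions. *)
  pose D : set (T * measurableTypeR R) :=
    [set p | 0 <= p.2] `&` [set p | p.2 <= r p.1] `&` [set p | p.2 <= h].
  have mD : measurable D.
    apply: measurableI; first apply: measurableI; apply: mle => //.
    by apply: measurableT_comp.
  rewrite (_ : (fun _ => _) = \1_D); first exact: measurable_indic.
  apply/funext => p; rewrite !indicE; congr (nat_of_bool _)%:R.
  apply/idP/idP; rewrite !inE/= in_itv/= le_min /D/=.
    by move=> /and3P[-> -> ->].
  by move=> [[-> ->] ->].
transitivity (\int[mu]_eta \int[P]_x F (x, eta))%E.
  rewrite integral_mkcond; apply: eq_integral => eta _.
  rewrite patchE; case: ifPn.
    rewrite inE/= in_itv/= => /andP[eta0 etah].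
    have mA : measurable [set x | eta <= r x].
      by rewrite -[X in measurable X]setTI; exact: measurable_fun_le.
    rewrite /wP fineK ?fin_num_measure// -[in LHS](setIT [set x | _]).
    rewrite -integral_indic//.
    apply: eq_integral => x _; rewrite /F /= !indicE; congr (nat_of_bool _)%:R%:E.
    by apply/idP/idP; rewrite !inE/= in_itv/= le_min eta0 etah andbT.
  move=> /negP nin; apply/esym/integral0_eq => x _.
  rewrite /F /= indicE memNset//= in_itv/= le_min => /and3P[eta0 _ etah].
  by apply: nin; rewrite inE/= in_itv/= eta0.
rewrite -(fubini_tonelli F)//; last by move=> p; rewrite /F lee_fin.
apply: eq_integral => x _.
rewrite /F /= integral_indic// setIT /= lebesgue_measure_itv/= lte_fin.
have m0 : 0 <= Num.min (r x) h by rewrite le_min r0.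
(* The measure of an interval is given by cases; the degenerate one returns 0, which is then the
   value of the minimum. *)
case: ltP => [_|m0']; first by rewrite sube0.
by have /eqP -> : Num.min (r x) h == 0 by rewrite eq_le m0' m0.
Qed.

(** * Second moments of sums over an i.i.d. sample *)

Lemma iid_law_pair {d d'} {T : measurableType d} {Om : measurableType d'}
    {R : realType} (Pr : probability Om R) (P : probability T R) (n : nat)
    (X : 'I_n -> Om -> T) (i j : 'I_n) (A B : set T) :
  iid_law Pr P X -> i != j -> measurable A -> measurable B ->
  (Pr ((fun w => (X i w, X j w)) @^-1` (A `*` B)) = P A * P B)%E.
Proof.
move=> [mX [lawX indX]] ij mA mB.
(* The product formula speaks of all n coordinates at once; taking the whole space at every index
   other than i and j leaves only the pair. *)
pose C (k : 'I_n) := if k == i then A else if k == j then B else setT.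
have mC k : measurable (C k) by rewrite /C; case: ifP => // _; case: ifP.
have -> : (fun w => (X i w, X j w)) @^-1` (A `*` B) = \bigcap_k (X k @^-1` C k).
  apply/seteqP; split => w /=.
    move=> [wA wB] k _; rewrite /C /preimage/=.
    by case: eqP => [->//|_]; case: eqP => [->|].
  move=> wC; split.
    by have := wC i I; rewrite /C /preimage/= eqxx.
  by have := wC j I; rewrite /C /preimage/= eq_sym (negbTE ij) eqxx.
rewrite indX// (bigD1 i)//= (bigD1 j)/=; last by rewrite eq_sym.
rewrite big1 ?mule1; last first.
  by move=> k /andP[ki kj]; rewrite lawX// /C (negbTE ki) (negbTE kj)/=
    probability_setT.
by rewrite !lawX// /C eqxx eq_sym (negbTE ij) eqxx.
Qed.

Lemma ge0_integral_iid {d d'} {T : measurableType d} {Om : measurableType d'}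
    {R : realType} (Pr : probability Om R) (P : probability T R) (n : nat)
    (X : 'I_n -> Om -> T) (i : 'I_n) (f : T -> \bar R) :
  iid_law Pr P X -> measurable_fun setT f -> (forall x, (0 <= f x)%E) ->
  (\int[Pr]_w f (X i w) = \int[P]_x f x)%E.
Proof.
move=> [mX [lawX _]] mf f0.
have := ge0_integral_pushforward (mX i) Pr measurableT mf (fun x _ => f0 x).
rewrite preimage_setT /comp => <-.
by apply: eq_measure_integral => A mA _; rewrite -(lawX i).
Qed.

(** Domination by f^2 + g^2: from (|f| - |g|)^2 >= 0 comes 2 |f g| <= f^2 + g^2. *)
Lemma integrable_mul {d} {T : measurableType d} {R : realType}
    (mu : {measure set T -> \bar R}) (f g : T -> R) :
  measurable_fun setT f -> measurable_fun setT g ->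
  mu.-integrable setT (fun x => (f x ^+ 2)%:E) ->
  mu.-integrable setT (fun x => (g x ^+ 2)%:E) ->
  mu.-integrable setT (fun x => (f x * g x)%:E).
Proof.
move=> mf mg if2 ig2; have := integrableD measurableT if2 ig2.
apply: le_integrable => //.
  by apply/measurable_EFinP; exact: measurable_funM.
move=> x _ /=; rewrite lee_fin normrM [leRHS]ger0_norm ?addr_ge0 ?sqr_ge0//.
rewrite -(real_normK (num_real (f x))) -(real_normK (num_real (g x))).
have := sqr_ge0 (`|f x| - `|g x|).
have := mulr_ge0 (normr_ge0 (f x)) (normr_ge0 (g x)).
by lra.
Qed.

Lemma integrable_sqr {d} {T : measurableType d} {R : realType}
    (mu : {measure set T -> \bar R}) (f : T -> R) (c : R) :
  measurable_fun setT f -> (\int[mu]_x (f x ^+ 2)%:E <= c%:E)%E ->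
  mu.-integrable setT (fun x => (f x ^+ 2)%:E).
Proof.
move=> mf fc; apply/integrableP; split.
  by apply/measurable_EFinP; exact: measurable_funX.
under eq_integral do rewrite gee0_abs ?lee_fin ?sqr_ge0//.
exact: (le_lt_trans fc (ltry c)).
Qed.

Lemma integrable_of_sqr {d} {T : measurableType d} {R : realType}
    (P : probability T R) (f : T -> R) :
  measurable_fun setT f -> P.-integrable setT (fun x => (f x ^+ 2)%:E) ->
  P.-integrable setT (EFin \o f).
Proof.
move=> mf if2.
have i1 : P.-integrable setT (fun x => (cst 1 x ^+ 2)%:E).
  under eq_fun do rewrite /= expr1n.
  exact: finite_measure_integrable_cst.
have := integrable_mul P f (cst 1) mf (measurable_cst _) if2 i1.
by apply: eq_integrable => // x _ /=; rewrite mulr1.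
Qed.

(** The joint law of (X_i, X_j) agrees with the product of [P] with itself on rectangles, hence
    everywhere, and Fubini factorises the integral. *)
Lemma integral_iid_pair {d d'} {T : measurableType d} {Om : measurableType d'}
    {R : realType} (Pr : probability Om R) (P : probability T R) (n : nat)
    (X : 'I_n -> Om -> T) (i j : 'I_n) (f g : T -> R) :
  iid_law Pr P X -> i != j ->
  P.-integrable setT (EFin \o f) -> P.-integrable setT (EFin \o g) ->
  (\int[Pr]_w (f (X i w) * g (X j w))%:E
   = \int[P]_x (f x)%:E * \int[P]_x (g x)%:E)%E.
Proof.
move=> iid ij intf intg.
have [mX _] := iid.
have /measurable_EFinP mf := measurable_int _ intf.
have /measurable_EFinP mg := measurable_int _ intg.
pose Z w := (X i w, X j w).
have mZ : measurable_fun setT Z by exact: measurable_fun_pair.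
pose F (p : T * T) : \bar R := (f p.1 * g p.2)%:E.
have mF : measurable_fun setT F.
  by apply/measurable_EFinP; apply: measurable_funM; exact: measurableT_comp.
have law A : measurable A -> (P \x P)%E A = pushforward Pr Z A.
  move=> mA; apply: product_measure_unique => // B C mB mC.
  exact: iid_law_pair iid ij mB mC.
(* The iterated integral of |f(x) g(y)| is the product of the integrals of |f| and |g|, both
   finite. *)
have intF : (P \x P)%E.-integrable setT F.
  apply/(integrable12ltyP P P mF).
  rewrite /F /=.
  under eq_integral => x _.
    under eq_integral do rewrite normrM EFinM.
    rewrite ge0_integralZl_EFin//=; last first.
      by apply/measurable_EFinP; exact: measurableT_comp.
    over.
  rewrite /= ge0_integralZr//=; first last.
  - exact: integral_ge0.
  - by apply/measurable_EFinP; exact: measurableT_comp.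
  apply: lte_mul_pinfty; first exact: integral_ge0.
  - by have := integrable_fin_num measurableT (integrable_abse intf).
  - by have /integrableP[_] := intg.
transitivity (\int[pushforward Pr Z]_p F p)%E.
  rewrite (integral_pushforward mZ mF)//.
  rewrite preimage_setT.
  apply/integrableP; split; first exact: measurableT_comp.
  have /integrableP[_] := intF.
  rewrite (eq_measure_integral (pushforward Pr Z)).
    rewrite ge0_integral_pushforward//.
    exact: measurableT_comp.
  by move=> A mA _; exact: law.
rewrite (eq_measure_integral (P \x P)%E); last first.
  by move=> A mA _; apply/esym; exact: law.
rewrite -integral12_prod_meas1// /fubini_F /F /=.
under eq_integral => x _.
  under eq_integral do rewrite EFinM.
  rewrite integralZl//; over.
rewrite /= -(fineK (integrable_fin_num measurableT intg)) integralZr//.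
Qed.

(** Expand the square into a double sum: each diagonal term contributes the second moment of [h],
    and each cross term is a product of two zero means. *)
Lemma integral_sum_sqr_iid {d d'} {T : measurableType d} {Om : measurableType d'}
    {R : realType} (Pr : probability Om R) (P : probability T R) (n : nat)
    (X : 'I_n -> Om -> T) (h : T -> R) :
  iid_law Pr P X -> measurable_fun setT h ->
  P.-integrable setT (fun x => (h x ^+ 2)%:E) ->
  (\int[P]_x (h x)%:E = 0)%E ->
  (\int[Pr]_w ((\sum_(i < n) h (X i w)) ^+ 2)%:E
   = n%:R%:E * \int[P]_x (h x ^+ 2)%:E)%E.
Proof.
move=> iid mh ih2 h0.
have [mX _] := iid.
have ih := integrable_of_sqr P h mh ih2.
have mhX i : measurable_fun setT (fun w => h (X i w)) by exact: measurableT_comp.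
have mh2 : measurable_fun setT (fun x => (h x ^+ 2)%:E).
  by apply/measurable_EFinP; exact: measurable_funX.
have ihX2 i : Pr.-integrable setT (fun w => (h (X i w) ^+ 2)%:E).
  apply/integrableP; split; first exact: (measurableT_comp mh2).
  under eq_integral do rewrite gee0_abs ?lee_fin ?sqr_ge0//.
  rewrite (ge0_integral_iid Pr P n X i (fun x => (h x ^+ 2)%:E))//; last first.
    by move=> x; rewrite lee_fin sqr_ge0.
  have /integrableP[_] := ih2.
  by under eq_integral do rewrite gee0_abs ?lee_fin ?sqr_ge0//.
have ihX i j : Pr.-integrable setT (fun w => (h (X i w) * h (X j w))%:E).
  exact: integrable_mul.
under eq_integral => w _.
  rewrite expr2 mulr_suml -sumEFin.
  under eq_bigr do rewrite mulr_sumr -sumEFin.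
  over.
rewrite integral_sum//; last by move=> i; exact: integrable_sum.
transitivity (\sum_(i < n) \int[P]_x (h x ^+ 2)%:E)%E.
  apply: eq_bigr => i _; rewrite integral_sum// (bigD1 i)//= big1 ?adde0.
    under eq_integral do rewrite -expr2.
    rewrite (ge0_integral_iid Pr P n X i (fun x => (h x ^+ 2)%:E))// => x.
    by rewrite lee_fin sqr_ge0.
  move=> j ji; rewrite (integral_iid_pair Pr P n X i j)//; last by rewrite eq_sym.
  by rewrite h0 mul0e.
rewrite -(fineK (integrable_fin_num measurableT ih2)).
by rewrite sumEFin sumr_const card_ord -EFinM mulr_natl.
Qed.

(** * Monte Carlo error of a square-integrable function *)

Lemma integral_sqr_center_le {d} {T : measurableType d} {R : realType}
    (P : probability T R) (g : T -> R) :
  measurable_fun setT g -> P.-integrable setT (fun x => (g x ^+ 2)%:E) ->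
  P.-integrable setT (EFin \o g) ->
  (\int[P]_x ((g x - fine (\int[P]_y (g y)%:E)) ^+ 2)%:E
    <= \int[P]_x (g x ^+ 2)%:E)%E.
Proof.
move=> mg ig2 ig; set m := fine _.
have mE : (\int[P]_x (g x)%:E = m%:E)%E.
  by rewrite fineK//; exact: integrable_fin_num.
pose k x : R := 2 * m * g x - m ^+ 2.
have i1 : P.-integrable setT (EFin \o (fun x => 2 * m * g x)).
  by have := integrableZl measurableT (2 * m) ig; apply: eq_integrable.
have i2 : P.-integrable setT (EFin \o cst (m ^+ 2)).
  exact: finite_measure_integrable_cst.
have ik : P.-integrable setT (EFin \o k).
  have := integrableB measurableT i1 i2.
  by apply: eq_integrable.
have kE : (\int[P]_x (k x)%:E = (m ^+ 2)%:E)%E.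
  under eq_integral do rewrite EFinB.
  rewrite integralB_EFin//; under eq_integral do rewrite EFinM.
  rewrite integralZl// mE integral_cst//= probability_setT mule1 -EFinM -EFinB.
  by congr EFin; ring.
under eq_integral => x _.
  rewrite (_ : (g x - m) ^+ 2 = g x ^+ 2 - k x); last by rewrite /k; ring.
  rewrite EFinB; over.
rewrite integralB_EFin// kE leeBlDr// leeDl// lee_fin sqr_ge0//.
Qed.

(** The first moment of the error is at most the root of the second; for the centred function [h]
    the latter is n^-2 * n times the variance, hence at most s^2 / n. *)
Lemma integral_monte_carlo_error {d d'} {T : measurableType d}
    {Om : measurableType d'} {R : realType} (Pr : probability Om R)
    (P : probability T R) (n : nat) (X : 'I_n -> Om -> T) (g : T -> R) (s : R) :
  iid_law Pr P X -> (0 < n)%N -> measurable_fun setT g -> 0 <= s ->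
  (\int[P]_x (g x ^+ 2)%:E <= (s ^+ 2)%:E)%E ->
  (\int[Pr]_w `|n%:R^-1 * \sum_(i < n) g (X i w) - fine (\int[P]_x (g x)%:E)|%:E
    <= (s / Num.sqrt n%:R)%:E)%E.
Proof.
move=> iid n0 mg s0 gs; set m := fine _.
have [mX _] := iid.
have ig2 := integrable_sqr P g (s ^+ 2) mg gs.
have ig := integrable_of_sqr P g mg ig2.
pose h x := g x - m.
have mh : measurable_fun setT h by exact: measurable_funB.
have hg : (\int[P]_x (h x ^+ 2)%:E <= \int[P]_x (g x ^+ 2)%:E)%E.
  exact: integral_sqr_center_le.
have ih2 := integrable_sqr P h (s ^+ 2) mh (le_trans hg gs).
have h0 : (\int[P]_x (h x)%:E = 0)%E.
  under eq_integral do rewrite EFinB.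
  rewrite (integralB_EFin (f2 := cst m))//; last first.
    exact: finite_measure_integrable_cst.
  rewrite /= integral_cst//= probability_setT mule1 fineK ?subee//;
    exact: integrable_fin_num.
have n0R : 0 < n%:R :> R by rewrite ltr0n.
have mS : measurable_fun setT (fun w => \sum_(i < n) h (X i w)).
  by apply: measurable_sum => i; exact: measurableT_comp.
under eq_integral => w _.
  rewrite (_ : _ - m = n%:R^-1 * \sum_(i < n) h (X i w)); last first.
    rewrite sumrB sumr_const card_ord mulrBr -[m *+ n]mulr_natl mulKf//.
    by rewrite gt_eqF.
  over.
apply: (integral_abs_le_sqrt Pr (fun w => n%:R^-1 * \sum_(i < n) h (X i w))).
- exact: measurable_funM.
- by rewrite divr_ge0// sqrtr_ge0.
under eq_integral do rewrite exprMn EFinM.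
rewrite (ge0_integralZl_EFin Pr measurableT) ?sqr_ge0//; last 2 first.
- by move=> w _; rewrite lee_fin sqr_ge0.
- by apply/measurable_EFinP; exact: measurable_funX.
rewrite (integral_sum_sqr_iid Pr P n X h)//.
rewrite muleA -EFinM.
apply: (@le_trans _ _ ((n%:R^-1 ^+ 2 * n%:R)%:E * (s ^+ 2)%:E)%E).
  by apply: lee_wpmul2l; [rewrite lee_fin mulr_ge0// sqr_ge0|exact: le_trans gs].
rewrite -EFinM lee_fin expr_div_n sqr_sqrtr ?ler0n//.
by rewrite le_eqVlt; apply/orP; left; apply/eqP; field; rewrite gt_eqF.
Qed.

(** * Signed integrals against the density, and the tail above the cut *)

Lemma is_density_integral1 {d} {T : measurableType d} {R : realType}
    (P Q : probability T R) (r : T -> R) :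
  is_density P Q r -> (\int[P]_x (r x)%:E = 1)%E.
Proof. by move=> [_ [_ Qr]]; rewrite -Qr//; exact: probability_setT. Qed.

Lemma integral_density {d} {T : measurableType d} {R : realType}
    (P Q : probability T R) (r : T -> R) (f : T -> R) :
  Q `<< P -> is_density P Q r -> Q.-integrable setT (EFin \o f) ->
  P.-integrable setT (fun x => (f x * r x)%:E) /\
  (\int[Q]_x (f x)%:E = \int[P]_x (f x * r x)%:E)%E.
Proof.
move=> QP dens iQf; have [mr [r0 _]] := dens.
have /measurable_EFinP mf := measurable_int _ iQf.
have mnf : measurable_fun setT (fun x => `|f x|) by exact: measurableT_comp.
have mfr : measurable_fun setT (fun x => f x * r x) by exact: measurable_funM.
have iQnf : Q.-integrable setT (EFin \o (fun x => `|f x|)).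
  exact: (integrable_norm iQf).
have normE : (\int[Q]_x `|f x|%:E = \int[P]_x (`|f x| * r x)%:E)%E.
  by apply: ge0_integral_density.
have iPnf : P.-integrable setT (EFin \o (fun x => `|f x| * r x)).
  apply/integrableP; split.
    by apply/measurable_EFinP; exact: measurable_funM.
  under eq_integral do rewrite /= ger0_norm ?mulr_ge0//.
  rewrite -normE; have /integrableP[_] := iQnf.
  by under eq_integral do rewrite /= normr_id.
have iPf : P.-integrable setT (EFin \o (fun x => f x * r x)).
  apply: le_integrable iPnf => //; first exact/measurable_EFinP.
  by move=> x _ /=; rewrite !normrM normr_id.
split => //.
(* Reduction to nonnegative functions: f = (f + |f|) - |f|, where the integral of |f| is finite and
   can be subtracted on both sides. *)
have posE : (\int[Q]_x (f x + `|f x|)%:E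
    = \int[P]_x ((f x + `|f x|) * r x)%:E)%E.
  apply: ge0_integral_density => //; first exact: measurable_funD.
  by move=> x; have := ler_norm (- f x); rewrite normrN; lra.
move: posE.
under eq_integral do rewrite EFinD.
rewrite (integralD_EFin measurableT iQf iQnf).
under [RHS]eq_integral do rewrite mulrDl EFinD.
rewrite (integralD_EFin measurableT iPf iPnf) normE.
have nfin := integrable_fin_num measurableT iPnf.
by move=> /(congr1 (fun z => z - \int[P]_x (`|f x| * r x)%:E))%E; rewrite !addeK.
Qed.

(** [r] has total mass 1 and min(r, a) has mass W_P(a) by the layer-cake formula. Domination by [r]
    makes that mass finite, so the [fine] in [WP] loses nothing. *)
Lemma integral_excess_SP {d} {T : measurableType d} {R : realType}
    (P Q : probability T R) (r : T -> R) (a : R) :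
  is_density P Q r -> 0 <= a ->
  (\int[P]_x (r x - Num.min (r x) a)%:E = (SP P r a)%:E)%E.
Proof.
move=> dens a0; have [mr [r0 _]] := dens.
have r1 := is_density_integral1 P Q r dens.
have ir : P.-integrable setT (EFin \o r).
  apply/integrableP; split; first exact/measurable_EFinP.
  under eq_integral do rewrite /= ger0_norm//.
  by rewrite r1 ltry.
have mm : measurable_fun setT (fun x => Num.min (r x) a) by exact: measurable_minr.
have im : P.-integrable setT (EFin \o (fun x => Num.min (r x) a)).
  apply: le_integrable ir => //; first exact/measurable_EFinP.
  move=> x _ /=; rewrite lee_fin !ger0_norm ?le_min ?r0//.
  by rewrite ge_min lexx.
under eq_integral do rewrite EFinB.
rewrite (integralB_EFin measurableT ir im) r1 /SP /WP integral_wP//.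
by rewrite EFinB fineK//; exact: integrable_fin_num im.
Qed.

Lemma Lnorm2_sqr {d} {T : measurableType d} {R : realType}
    (mu : {measure set T -> \bar R}) (f : T -> R) :
  ('N[mu]_2%:E[EFin \o f] < +oo)%E ->
  (\int[mu]_x (f x ^+ 2)%:E = (fine ('N[mu]_2%:E[EFin \o f])%E ^+ 2)%:E)%E.
Proof.
move=> Nfin.
have N0 : (0 <= 'N[mu]_2%:E[EFin \o f])%E by exact: Lnorm_ge0.
have := @poweR_Lnorm _ _ _ mu (EFin \o f) 2 (negbT (gt_eqF (ltr0n R 2))).
rewrite -(fineK (_ : 'N[mu]_2%:E[EFin \o f]%E \is a fin_num)).
  rewrite poweR_EFin powR_mulrn ?fine_ge0// => ->.
  apply: eq_integral => x _.
  by rewrite /= powR_mulrn// real_normK ?num_real.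
by rewrite ge0_fin_numE.
Qed.

Lemma integral_abs_tail_le {d} {T : measurableType d} {R : realType}
    (P Q : probability T R) (r phi : T -> R) (a : R) :
  Q `<< P -> is_density P Q r -> measurable_fun setT phi ->
  ('N[Q]_2%:E[EFin \o phi] < +oo)%E -> 0 <= a ->
  (\int[P]_x (`|phi x| * (r x - Num.min (r x) a))%:E
    <= (fine ('N[Q]_2%:E[EFin \o phi])%E * Num.sqrt (SP P r a))%:E)%E.
Proof.
move=> QP dens mphi Nfin a0; have [mr [r0 _]] := dens.
pose q x := r x - Num.min (r x) a.
have q0 x : 0 <= q x by rewrite subr_ge0 ge_min lexx.
have qr x : q x <= r x by rewrite gerBl le_min r0.
have mq : measurable_fun setT q.
  by apply: measurable_funB => //; exact: measurable_minr.
have msqrt (u : T -> R) : measurable_fun setT u ->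
    measurable_fun setT (fun x => Num.sqrt (u x)).
  exact: (measurableT_comp (continuous_measurable_fun (@sqrt_continuous R))).
(* S_P(a) is the integral of the nonnegative excess [q]. *)
have S0 : 0 <= SP P r a.
  rewrite -lee_fin -(integral_excess_SP P Q r a dens a0).
  by apply: integral_ge0 => x _; rewrite lee_fin q0.
have CS := cauchy_schwarz_le P (fun x => phi x * Num.sqrt (r x))
  (fun x => Num.sqrt (q x)) (fine ('N[Q]_2%:E[EFin \o phi])%E)
  (Num.sqrt (SP P r a)).
apply: le_trans (CS _ _ _ _ _ _).
- apply: ge0_le_integral => //.
  + by move=> x _; rewrite lee_fin mulr_ge0// q0.
  + by apply/measurable_EFinP; apply: measurable_funM => //; exact: measurableT_comp.
  + apply/measurable_EFinP; apply: measurableT_comp => //.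
    by apply: measurable_funM; [apply: measurable_funM => //|]; exact: msqrt.
  (* Since q <= r, q = sqrt q * sqrt q <= sqrt r * sqrt q. The factor sqrt r turns the second moment
     of phi under [Q] into one under [P]. *)
  + move=> x _; rewrite lee_fin -/(q x) !normrM -mulrA ler_wpM2l//.
    rewrite !ger0_norm ?sqrtr_ge0// -[leLHS]sqr_sqrtr// expr2.
    by rewrite ler_wpM2r ?sqrtr_ge0// ler_wsqrtr.
- by apply: measurable_funM => //; exact: msqrt.
- exact: msqrt.
- by rewrite fine_ge0// Lnorm_ge0.
- exact: sqrtr_ge0.
- rewrite -Lnorm2_sqr// (ge0_integral_density P Q r (fun x => phi x ^+ 2))//.
  + by under eq_integral do rewrite exprMn sqr_sqrtr//.
  + exact: measurable_funX.
  + by move=> x; exact: sqr_ge0.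
- rewrite sqr_sqrtr// -(integral_excess_SP P Q r a dens a0).
  by under eq_integral do rewrite sqr_sqrtr//.
Qed.

(** * The error bound for an arbitrary cut height, then the choice of height *)

Lemma importance_sampling_error {d d'} {T : measurableType d}
    {Om : measurableType d'} {R : realType} (Pr : probability Om R)
    (P Q : probability T R) (n : nat) (X : 'I_n -> Om -> T)
    (r phi : T -> R) (a : R) :
  Q `<< P -> is_density P Q r -> measurable_fun setT phi ->
  ('N[Q]_2%:E[EFin \o phi] < +oo)%E -> (0 < n)%N -> iid_law Pr P X -> 0 <= a ->
  (\int[Pr]_w `|In_est (fun i => X i w) phi r
                - fine (\int[Q]_x (phi x)%:E)|%:E
    <= 'N[Q]_2%:E[EFin \o phi] *
       (Num.sqrt a / Num.sqrt n%:R + 2 * Num.sqrt (SP P r a))%:E)%E.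
Proof.
move=> QP dens mphi Nfin n0 iid a0.
have [mr [r0 _]] := dens; have [mX _] := iid.
have tail := integral_abs_tail_le P Q r phi a QP dens mphi Nfin a0.
have phi2 := Lnorm2_sqr Q phi Nfin.
have Nfn : 'N[Q]_2%:E[EFin \o phi]%E \is a fin_num.
  by rewrite ge0_fin_numE// Lnorm_ge0.
rewrite -(fineK Nfn); set N := fine _ in tail phi2 *.
have N0 : 0 <= N by rewrite fine_ge0// Lnorm_ge0.
set S := SP P r a in tail *.
(* [g] is the truncated integrand and [q] the modulus of what truncation removes from phi * r. *)
pose g x := phi x * Num.min (r x) a.
pose q x := `|phi x| * (r x - Num.min (r x) a).
have mm : measurable_fun setT (fun x => Num.min (r x) a) by exact: measurable_minr.
have mg : measurable_fun setT g by exact: measurable_funM.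
have mq : measurable_fun setT q.
  by apply: measurable_funM; [exact: measurableT_comp|exact: measurable_funB].
have q0 x : 0 <= q x by rewrite mulr_ge0// subr_ge0 ge_min lexx.
have qE x : `|phi x * r x - g x| = q x.
  by rewrite -mulrBr normrM (ger0_norm (_ : 0 <= r x - _))// subr_ge0 ge_min lexx.
(* Pointwise g^2 <= a * phi^2 * r, and phi^2 * r integrates to N^2 under [P]. *)
have g2 : (\int[P]_x (g x ^+ 2)%:E <= ((N * Num.sqrt a) ^+ 2)%:E)%E.
  rewrite exprMn sqr_sqrtr// mulrC EFinM -phi2.
  rewrite (ge0_integral_density P Q r (fun x => phi x ^+ 2))//; last 2 first.
  - exact: measurable_funX.
  - by move=> x; exact: sqr_ge0.
  rewrite -ge0_integralZl_EFin//; last 2 first.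
  - by move=> x _; rewrite lee_fin mulr_ge0// sqr_ge0.
  - by apply/measurable_EFinP; apply: measurable_funM => //; exact: measurable_funX.
  apply: ge0_le_integral => //.
  - by move=> x _; rewrite lee_fin sqr_ge0.
  - by apply/measurable_EFinP; exact: measurable_funX.
  - apply/measurable_EFinP; apply: measurable_funM => //; apply: measurable_funM => //.
    exact: measurable_funX.
  move=> x _; rewrite -EFinM lee_fin exprMn [leRHS]mulrCA ler_wpM2l ?sqr_ge0//.
  rewrite expr2 [leRHS]mulrC.
  by apply: ler_pM; rewrite ?le_min ?r0// ge_min lexx ?orbT//.
have MC := integral_monte_carlo_error Pr P n X g (N * Num.sqrt a) iid n0 mg
  (mulr_ge0 N0 (sqrtr_ge0 a)) g2.
have ig : P.-integrable setT (EFin \o g).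
  by apply: integrable_of_sqr => //; exact: integrable_sqr g2.
have iphi : Q.-integrable setT (EFin \o phi).
  apply: integrable_of_sqr => //.
  by apply: (integrable_sqr _ _ (N ^+ 2)); rewrite ?phi2.
have [ipr ->] := integral_density P Q r phi QP dens iphi.
set I := fine _; set m := fine (\int[P]_x (g x)%:E)%E in MC.
(* First use of the tail bound: the shift of the mean caused by truncation. *)
have bias : `|m - I| <= N * Num.sqrt S.
  rewrite -lee_fin; apply: (le_trans _ tail).
  rewrite -abse_EFin EFinB !fineK; [|exact: integrable_fin_num ..].
  rewrite -(integralB_EFin measurableT ig ipr).
  apply: le_trans (le_abse_integral _ measurableT _) _.
    apply: emeasurable_funB; apply/measurable_EFinP => //.
    exact: measurable_funM.
  by under eq_integral do rewrite -EFinB abse_EFin distrC qE.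
have n0R : 0 < n%:R :> R by rewrite ltr0n.
have mqX i : measurable_fun setT (fun w => q (X i w)) by exact: measurableT_comp.
have mgX i : measurable_fun setT (fun w => g (X i w)) by exact: measurableT_comp.
have mprX i : measurable_fun setT (fun w => phi (X i w) * r (X i w)).
  by apply: measurable_funM; exact: measurableT_comp.
pose A w := n%:R^-1 * \sum_(i < n) q (X i w).
pose B w := `|n%:R^-1 * \sum_(i < n) g (X i w) - m|.
have mA : measurable_fun setT A.
  by apply: measurable_funM => //; exact: measurable_sum.
have mB : measurable_fun setT B.
  apply: measurableT_comp => //; apply: measurable_funB => //.
  by apply: measurable_funM => //; exact: measurable_sum.
have A0 w : 0 <= A w by rewrite mulr_ge0 ?invr_ge0 ?ler0n// sumr_ge0.
(* Second use of the tail bound: every X_i has law [P], so the expected sample mean of [q] is the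
   integral of [q]. *)
have iA : (\int[Pr]_w (A w)%:E <= (N * Num.sqrt S)%:E)%E.
  apply: (le_trans _ tail).
  under eq_integral do rewrite EFinM -sumEFin.
  rewrite ge0_integralZl_EFin//; last 2 first.
  - by move=> w _; apply: sume_ge0 => i _; rewrite lee_fin.
  - under eq_fun do rewrite sumEFin.
    by apply/measurable_EFinP; exact: measurable_sum.
  rewrite ge0_integral_sum//; last 2 first.
  - by move=> i; apply/measurable_EFinP.
  - by move=> i w _; rewrite lee_fin.
  rewrite (eq_bigr (fun=> \int[P]_x (q x)%:E)%E); last first.
    move=> i _; apply: (ge0_integral_iid Pr P n X i (fun x => (q x)%:E)) => //.
    exact/measurable_EFinP.
  (* Finiteness moves the computation into [R], where the n equal terms cancel against n^-1. *)
  have iq : (\int[P]_x (q x)%:E)%E \is a fin_num.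
    rewrite ge0_fin_numE; last by apply: integral_ge0 => x _; rewrite lee_fin.
    exact: (le_lt_trans tail (ltry _)).
  rewrite -(fineK iq) sumEFin sumr_const card_ord -EFinM -[X in _ * X]mulr_natl.
  by rewrite mulKf// gt_eqF.
apply: (@le_trans _ _ (\int[Pr]_w ((A w)%:E + (B w)%:E + `|m - I|%:E))%E).
  apply: ge0_le_integral => //.
  - apply/measurable_EFinP; apply: measurableT_comp => //.
    apply: measurable_funB => //; apply: measurable_funM => //.
    exact: measurable_sum.
  - by apply: emeasurable_funD => //; apply: emeasurable_funD; exact/measurable_EFinP.
  move=> w _; rewrite -!EFinD lee_fin.
  (* Three-way split: sample mean of the removed part, Monte Carlo error of [g], and bias m - I. *)
  have -> : In_est (fun i => X i w) phi r - I
    = n%:R^-1 * (\sum_(i < n) (phi (X i w) * r (X i w) - g (X i w)))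
      + (n%:R^-1 * \sum_(i < n) g (X i w) - m) + (m - I).
    by rewrite sumrB /In_est; ring.
  apply: le_trans (ler_normD _ _) _; rewrite lerD2r.
  apply: le_trans (ler_normD _ _) _; rewrite lerD2r.
  rewrite normrM ger0_norm ?invr_ge0 ?ler0n// /A ler_wpM2l ?invr_ge0 ?ler0n//.
  apply: le_trans (ler_norm_sum _ _ _) _.
  by apply: ler_sum => i _; rewrite qE.
rewrite ge0_integralD//; last 2 first.
- by move=> w _; rewrite -EFinD lee_fin; exact: addr_ge0 (A0 w) (normr_ge0 _).
- by apply: emeasurable_funD; exact/measurable_EFinP.
rewrite ge0_integralD//; last 4 first.
- by move=> w _; rewrite lee_fin; exact: A0.
- exact/measurable_EFinP.
- by move=> w _; rewrite lee_fin; exact: normr_ge0.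
- exact/measurable_EFinP.
rewrite integral_cst//= probability_setT mule1 -EFinM.
rewrite (_ : N * _ =
  N * Num.sqrt S + N * Num.sqrt a / Num.sqrt n%:R + N * Num.sqrt S); last by ring.
by rewrite !EFinD; apply: leeD; [exact: leeD|rewrite lee_fin].
Qed.

Theorem theorem3 (R : realType) (d : measure_display) (T : measurableType d)
  (P Q : probability T R) (r : T -> R) (L : R)
  (phi : T -> R) (t : R) (n : nat)
  (d' : measure_display) (Om : measurableType d') (Pr : probability Om R)
  (X : 'I_n -> Om -> T) :
  (Q `<< P) ->
  is_density P Q r ->
  (\int[Q]_x (log2 (r x))%:E)%E = L%:E ->
  measurable_fun setT phi ->
  ('N[Q]_2%:E[EFin \o phi] < +oo)%E ->
  0 <= t ->
  (0 < n)%N ->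
  n%:R = 2 `^ (L + t) ->
  iid_law Pr P X ->
  (\int[Pr]_w (`| In_est (fun i => X i w) phi r
                  - fine (\int[Q]_x (phi x)%:E)%E |)%:E <=
   'N[Q]_2%:E[EFin \o phi] *
     (2 `^ (- (t / 4)) + 2 * Num.sqrt (SP P r (2 `^ (L + t / 2))))%:E)%E.
Proof.
move=> QP dens _ mphi Nfin _ n0 nE iid.
have := importance_sampling_error Pr P Q n X r phi (2 `^ (L + t / 2)) QP dens
  mphi Nfin n0 iid (powR_ge0 _ _).
(* The exponents combine to (L + t/2)/2 - (L + t)/2 = -t/4. *)
suff -> : Num.sqrt (2 `^ (L + t / 2)) / Num.sqrt n%:R = 2 `^ (- (t / 4)) by [].
rewrite nE -!powR12_sqrt ?powR_ge0// -!powRrM -powRN -powRD; last first.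
  by rewrite pnatr_eq0 implybT.
by congr (2 `^ _); field.
Qed.
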